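(* For every compactly supported continuous function $f$ on $\mathbb{R}$, $$\lim_{N\to\infty}\|f-S_Nf\|_\infty=0.$$
   Context: $\|\cdot\|_\infty$ is the supremum norm on $\mathbb{R}$. B-splines: $N_1=\mathbf 1_{[0,1)}$, $N_m(x)=\int_0^1N_{m-1}(x-t)\,dt$ for $m\ge2$. Differences: $\Delta_h^mf(x)=\sum_{l=0}^m(-1)^{m-l}\binom ml f(x+hl)$. Cardinal cubic spline: $L^4(x)=\sum_{n\in\mathbb{Z}}(-1)^n\sqrt3\,(2-\sqrt3)^{|n|}N_4(x+2-n)$, which satisfies $L^4(j)=\delta_{j,0}$ for $j\in\mathbb{Z}$. For $N\in\mathbb{N}$ the operator $S_N$ is $$S_Nf(x)=\sum_{k\in\mathbb{Z}}f(k)L^4(x-k)+\sum_{j=0}^{N-1}\sum_{k\in\mathbb{Z}}\lambda_{j,k}(f)\,s_{j,k}(x),$$ $$\lambda_{j,k}(f)=\frac16\left(\Delta^4_{2^{-j-1}}f\Big(\frac{2k}{2^{j+1}}\Big)-4\Delta^4_{2^{-j-1}}f\Big(\frac{2k+1}{2^{j+1}}\Big)+\Delta^4_{2^{-j-1}}f\Big(\frac{2k+2}{2^{j+1}}\Big)\right),$$ $s_{j,k}(x)=\sum_{n\in\mathbb{Z}}a_n\,v(2^jx-k-n)$, with $$a_n=\begin{cases}(-6-4\sqrt3)(-2-\sqrt3)^{n-1}+\left(6+\tfrac{7\sqrt3}{2}\right)(7+4\sqrt3)^{n-1}, & n\le 1,\\(6-4\sqrt3)(-2+\sqrt3)^{n-1}+\left(-6+\tfrac{7\sqrt3}{2}\right)(7-4\sqrt3)^{n-1},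 & n>1,\end{cases}$$ $$v(t)=\frac1{36}\begin{cases}t^3,&0\le t\le 1/2,\\1-6t+12t^2-7t^3,&1/2<t\le1,\\-22+63t-57t^2+16t^3,&1<t\le3/2,\\86-153t+87t^2-16t^3,&3/2<t\le2,\\-98+123t-51t^2+7t^3,&2<t\le5/2,\\27-27t+9t^2-t^3,&5/2<t\le3,\\0,&\text{otherwise.}\end{cases}$$ *)

(* Defs.v *)
From HB Require Import structures.
From mathcomp Require Import all_boot all_order all_algebra.
From mathcomp Require Import all_classical all_reals all_analysis.

Set Implicit Arguments.
Unset Strict Implicit.
Unset Printing Implicit Defensive.

Import Order.TTheory GRing.Theory Num.Theory.
Import numFieldNormedType.Exports.

Local Open Scope classical_set_scope.
Local Open Scope ring_scope.

(* Two-sided series, as the sum of its two one-sided series.  In [SN] below, for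
   compactly supported f, every such series has finitely many nonzero terms. *)
Definition zsum (R : realType) (u : int -> R) : R :=
  limn (series (fun n : nat => u n%:Z))
  + limn (series (fun n : nat => u (- (n.+1%:Z)))).

(* The value in \bar R makes the norm of an unbounded function +oo. *)
Definition supnorm (R : realType) (g : R -> R) : \bar R :=
  ereal_sup [set `|g x|%:E | x in [set: R]].

Definition compactly_supported (R : realType) (f : R -> R) : Prop :=
  compact (closure [set x | f x != 0]).

(* The index starts at 1; the value at 0 is a dummy. *)
Fixpoint bspline (R : realType) (m : nat) : R -> R :=
  match m with
  | 0 => fun=> 0
  | 1 => \1_(`[0, 1[%classic : set R)
  | (_.+1 as m').+1 => fun x =>
      \int[lebesgue_measure]_(t in `[0, 1]) bspline m' (x - t)
  end.

Definition fdiff (R : realType) (m : nat) (h : R) (f : R -> R) (x : R) : R :=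
  \sum_(l < m.+1) (-1) ^+ (m - l) * 'C(m, l)%:R * f (x + h * l%:R).

Definition L4 (R : realType) (x : R) : R :=
  zsum (fun n : int => (-1) ^ n * Num.sqrt 3 * (2 - Num.sqrt 3) ^+ `|n|%N
                       * bspline 4 (x + 2 - n%:~R)).

Definition lam (R : realType) (f : R -> R) (j : nat) (k : int) : R :=
  let h : R := 2 ^- j.+1 in
  6^-1 * (fdiff 4 h f ((2 * k)%:~R / 2 ^+ j.+1)
          - 4 * fdiff 4 h f ((2 * k + 1)%:~R / 2 ^+ j.+1)
          + fdiff 4 h f ((2 * k + 2)%:~R / 2 ^+ j.+1)).

Definition acoef (R : realType) (n : int) : R :=
  let r3 : R := Num.sqrt 3 in
  if (n <= 1)%R then
    (- 6 - 4 * r3) * (- 2 - r3) ^ (n - 1)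
    + (6 + 7 * r3 / 2) * (7 + 4 * r3) ^ (n - 1)
  else
    (6 - 4 * r3) * (- 2 + r3) ^ (n - 1)
    + (- 6 + 7 * r3 / 2) * (7 - 4 * r3) ^ (n - 1).

Definition vspline (R : realType) (t : R) : R :=
  36^-1 *
  (if (0 <= t <= 1 / 2) then t ^+ 3
   else if (1 / 2 < t <= 1) then 1 - 6 * t + 12 * t ^+ 2 - 7 * t ^+ 3
   else if (1 < t <= 3 / 2) then - 22 + 63 * t - 57 * t ^+ 2 + 16 * t ^+ 3
   else if (3 / 2 < t <= 2) then 86 - 153 * t + 87 * t ^+ 2 - 16 * t ^+ 3
   else if (2 < t <= 5 / 2) then - 98 + 123 * t - 51 * t ^+ 2 + 7 * t ^+ 3
   else if (5 / 2 < t <= 3) then 27 - 27 * t + 9 * t ^+ 2 - t ^+ 3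
   else 0).

Definition sjk (R : realType) (j : nat) (k : int) (x : R) : R :=
  zsum (fun n : int => acoef R n * vspline (2 ^+ j * x - k%:~R - n%:~R)).

Definition SN (R : realType) (N : nat) (f : R -> R) (x : R) : R :=
  zsum (fun k : int => f k%:~R * L4 (x - k%:~R))
  + \sum_(j < N) zsum (fun k : int => lam f j k * sjk j k x).

(* Main.v *)
(* S_N f is the cardinal cubic spline interpolant J_N f of f on the grid 2^-N Z: the
   two-scale relations
     L(2y) = L(y) + (s(y) + 23 s(y+1) + 23 s(y+2) + s(y+3)) / 6,
     L(2y-1) = - (8 s(y) + 32 s(y+1) + 8 s(y+2)) / 6,
   where L = L^4 and s = s_{0,0}, give
   J_{N+1} f - J_N f = sum_k lambda_{N,k}(f) s_{N,k}. Between consecutive half-integers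
   the relations are cubic polynomial identities, which follow from identities between
   the B-spline coefficients of L and of s.
   The B-spline coefficients d_n of J_N f satisfy
   d_{n-1} + 4 d_n + d_{n+1} = 6 f(n / 2^N) and are bounded, so that a maximum principle
   bounds d_n - f(n / 2^N) by the oscillation of f at scale 2^-N. As the B-splines form
   a partition of unity with local supports, uniform continuity of f concludes. *)

Require Import Defs.
From mathcomp Require Import all_boot all_order all_algebra.
From mathcomp Require Import all_classical all_reals all_analysis.
From mathcomp Require Import ring lra zify.

Import Order.TTheory GRing.Theory Num.Theory.
Import numFieldNormedType.Exports.

Local Open Scope classical_set_scope.
Local Open Scope ring_scope.

Set Implicit Arguments.
Unset Strict Implicit.
Unset Printing Implicit Defensive.

(** * Cubic B-splines *)

(** The truncated power of spline theory, for [k] at least 1; at [k = 0] it is the constant 1 and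
    not a step function. *)
Definition tpow (R : realType) (k : nat) (x : R) : R := Num.max x 0 ^+ k.

Lemma continuous_tpow (R : realType) (k : nat) : continuous (@tpow R k).
Proof.
move=> x.
apply: (@continuous_comp _ _ _ (fun x : R => Num.max x 0) (fun y => y ^+ k)).
  by apply: continuous_max; [exact: cvg_id|exact: cvg_cst].
exact: exprn_continuous.
Qed.

Lemma is_derive_tpow (R : realType) (k : nat) (x : R) :
  is_derive x 1 (@tpow R k.+2) (k.+2%:R * tpow k.+1 x).
Proof.
have [x0|x0|->] := ltrgtP x 0.
- rewrite [tpow k.+1 x]/tpow max_r ?(ltW x0)// expr0n/= mulr0.
  apply: (@near_eq_is_derive _ _ _ (cst 0)).
  near=> y; rewrite /tpow max_r ?expr0n//.
  by apply: ltW; near: y; exact: lt_nbhsl.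
- rewrite [tpow k.+1 x]/tpow max_l ?(ltW x0)//.
  have dX : is_derive x 1 (fun y : R => y ^+ k.+2) (k.+2%:R * x ^+ k.+1).
    by apply: DeriveDef; [exact: exprn_derivable|rewrite exp_derive [LHS]mulr1].
  apply: near_eq_is_derive dX; near=> y; rewrite /tpow max_l//.
  by apply: ltW; near: y; exact: lt_nbhsr.
- have t0 : tpow k.+1 (0 : R) = 0 by rewrite /tpow maxxx expr0n.
  rewrite t0 mulr0.
  (* At 0 the difference quotient in [h] is [tpow k.+1 h], which tends to 0 by continuity. *)
  have cv : (fun h : R => h^-1 *: (tpow k.+2 (h *: 1 + 0) - tpow k.+2 0)) @ 0^'
      --> (0 : R).
    have : tpow k.+1 @ (0 : R)^' --> (0 : R).
      apply: cvg_trans; first exact/cvg_app/nbhs_dnbhs.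
      by rewrite -{2}t0; exact: continuous_tpow.
    apply: cvg_trans; apply: near_eq_cvg; near=> h.
    have h0 : h != 0 by near: h; exact: nbhs_dnbhs_neq.
    rewrite /tpow maxxx expr0n subr0 addr0 [h *: 1]mulr1 [RHS]mulrC.
    have [hp|hn] := leP 0 h; last by rewrite !expr0n mul0r.
    by rewrite [in RHS]exprS mulrAC mulfV// mul1r.
  apply: DeriveDef; first by apply/cvg_ex; exists 0.
  exact/cvg_lim.
Unshelve. all: by end_near. Qed.

(** One step of the B-spline recursion: as a function of [t], [- G (x - t)] is an antiderivative of
    [g (x - t)]. *)
Lemma Rintegral_conv01 (R : realType) (G g : R -> R) (x : R) :
  continuous g -> (forall y : R, is_derive y 1 G (g y)) ->
  \int[lebesgue_measure]_(t in `[0, 1]) g (x - t) = G x - G (x - 1).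
Proof.
move=> cg dG.
have dF (t : R) : is_derive t 1 (fun t => - G (x - t)) (g (x - t)).
  have dB : is_derive t 1 (fun t => x - t) (-1 : R).
    have := is_deriveB (is_derive_cst (x : R) t (1 : R)) (is_derive_id t (1 : R)).
    by rewrite sub0r.
  have := @is_derive1_comp _ G (fun t => x - t) t _ _ (dG (x - t)) dB.
  by move=> /is_deriveN; rewrite mulrN1 opprK.
have cF : continuous (fun t => - G (x - t)).
  by move=> t; apply: differentiable_continuous; apply/derivable1_diffP; exact: ex_derive.
rewrite /Rintegral (@continuous_FTC2 _ _ (fun t => - G (x - t)))//.
- by rewrite -EFinB /= subr0 opprK addrC.
- apply: continuous_subspaceT => t.
  apply: (@continuous_comp _ _ _ (fun t : R => x - t) g); last exact: cg.
  by apply: cvgB; [exact: cvg_cst|exact: cvg_id].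
- split => //.
  + by apply: cvg_at_right_filter; exact: cF.
  + by apply: cvg_at_left_filter; exact: cF.
- by move=> t _; rewrite derive1E derive_val.
Qed.

(** The indicator [bspline 1] jumps, so this first integral is computed as the length of the
    intersection of []x - 1, x]] with [[0, 1]]. *)
Lemma bspline2E (R : realType) (x : R) :
  bspline 2 x = tpow 1 x - 2 * tpow 1 (x - 1) + tpow 1 (x - 2).
Proof.
rewrite /bspline.
have -> : \int[lebesgue_measure]_(t in `[0, 1]) \1_(`[0, 1[%classic : set R) (x - t)
    = \int[lebesgue_measure]_(t in `[0, 1]) \1_(`]x - 1, x]%classic : set R) t.
  apply: eq_Rintegral => t _; rewrite !indicE; congr (_ %:R); congr nat_of_bool.
  by apply/idP/idP; rewrite !inE /= !in_itv /= => /andP[? ?]; apply/andP; split; lra.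
rewrite /Rintegral integral_indic//.
have -> : `]x - 1, x]%classic `&` `[0, 1]%classic =
    [set` (`]x - 1, x] `&` `[0, 1])%O] by rewrite set_itvI.
apply: (etrans (congr1 fine (lebesgue_measure_itv (`]x - 1, x] `&` `[0, 1])%O))).
rewrite /= joinEtotal meetEtotal /tpow !expr1 lte_fin -EFinB.
rewrite !maxEle !minEle.
by case: (boolP (x - 1 <= 0)) => h1; case: (boolP (x <= 1)) => h2;
  case: (boolP (x <= 0)) => h3; case: (boolP (x - 2 <= 0)) => h4;
  try (exfalso; lra); case: ifP => /= h5; lra.
Qed.

Lemma Rintegral_conv01_tpow (R : realType) (k n : nat) (b : nat -> R) (x : R) :
  \int[lebesgue_measure]_(t in `[0, 1])
    (\sum_(l < n) b l * tpow k.+1 (x - t - l%:R)) =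
  \sum_(l < n) b l / k.+2%:R * (tpow k.+2 (x - l%:R) - tpow k.+2 (x - 1 - l%:R)).
Proof.
have dS (c : R) (l : nat) (y : R) : is_derive y 1 (fun y => c / k.+2%:R * tpow k.+2 (y - l%:R))
    (c * tpow k.+1 (y - l%:R)).
  have dB : is_derive y 1 (fun t => t - l%:R) (1 : R).
    have := is_deriveB (is_derive_id y (1 : R)) (is_derive_cst (l%:R : R) y (1 : R)).
    by rewrite subr0.
  have := @is_derive1_comp _ _ (fun t => t - l%:R) y _ _
    (is_derive_tpow k (y - l%:R)) dB.
  move=> /(is_deriveZ (c / k.+2%:R)).
  suff -> : c / k.+2%:R *: (k.+2%:R * tpow k.+1 (y - l%:R) * 1) =
    c * tpow k.+1 (y - l%:R) by [].
  by rewrite /GRing.scale /= mulr1 mulrA divfK// pnatr_eq0.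
pose g (y : R) := \sum_(l < n) b l * tpow k.+1 (y - l%:R).
pose G (y : R) := \sum_(l < n) b l / k.+2%:R * tpow k.+2 (y - l%:R).
have cg : continuous g.
  move=> y; apply: cvg_big => [|l _]; first exact: add_continuous.
  apply: cvgM; first exact: cvg_cst.
  apply: (@continuous_comp _ _ _ (fun t : R => t - l%:R) (tpow k.+1)).
    by apply: cvgB; [exact: cvg_id|exact: cvg_cst].
  exact: continuous_tpow.
have dG (y : R) : is_derive y 1 G (g y).
  pose F (l : 'I_n) (y : R) : R := b l / k.+2%:R * tpow k.+2 (y - l%:R).
  have := @is_derive_sum _ _ _ n F y 1 _ (fun l => dS (b l) l y).
  by rewrite fct_sumE.
rewrite (Rintegral_conv01 x cg dG) /G -sumrB.
by apply: eq_bigr => l _; rewrite mulrBr.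
Qed.

(** The fourth backward difference of [tpow 3], divided by 3!: each integration raises the exponent
    by one and applies one more difference. *)
Lemma bspline4E (R : realType) (x : R) :
  bspline 4 x = 6^-1 * (tpow 3 x - 4 * tpow 3 (x - 1) + 6 * tpow 3 (x - 2)
    - 4 * tpow 3 (x - 3) + tpow 3 (x - 4)).
Proof.
have b3 (y : R) : bspline 3 y = 2^-1 * (tpow 2 y - 3 * tpow 2 (y - 1)
    + 3 * tpow 2 (y - 2) - tpow 2 (y - 3)).
  rewrite [LHS]/=.
  transitivity (\int[lebesgue_measure]_(t in `[0, 1])
      (\sum_(l < 3) [:: 1; -2; 1]`_l * tpow 1 (y - t - l%:R))).
    apply: eq_Rintegral => t _; rewrite [LHS]bspline2E !big_ord_recr big_ord0 /=.
    by rewrite subr0; ring.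
  rewrite Rintegral_conv01_tpow !big_ord_recr big_ord0 /= subr0.
  rewrite (_ : y - 1 - 0 = y - 1); last ring.
  rewrite (_ : y - 1 - 1 = y - 2); last ring.
  rewrite (_ : y - 1 - 2 = y - 3); last ring.
  by field.
rewrite [LHS]/=.
transitivity (\int[lebesgue_measure]_(t in `[0, 1])
    (\sum_(l < 4) [:: 2^-1; - 3 / 2; 3 / 2; - 2^-1]`_l * tpow 2 (x - t - l%:R))).
  apply: eq_Rintegral => t _; rewrite [LHS]b3 !big_ord_recr big_ord0 /=.
  by rewrite subr0; field.
rewrite Rintegral_conv01_tpow !big_ord_recr big_ord0 /= subr0.
rewrite (_ : x - 1 - 0 = x - 1); last ring.
rewrite (_ : x - 1 - 1 = x - 2); last ring.
rewrite (_ : x - 1 - 2 = x - 3); last ring.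
rewrite (_ : x - 1 - 3 = x - 4); last ring.
by field.
Qed.

(** * Finitely supported sums over the integers *)

Lemma sum_window_shift (V : zmodType) (u : int -> V) (a b : int) (m n : nat) :
  (forall k, ~~ (a <= k < a + m%:Z) -> u k = 0) -> b <= a ->
  a + m%:Z <= b + n%:Z ->
  \sum_(i < n) u (b + i%:Z) = \sum_(i < m) u (a + i%:Z).
Proof.
move=> u0 ba ab.
have [d ad] : exists d : nat, a = b + d%:Z by exists `|a - b|%N; lia.
have [e ne] : exists e : nat, n = (d + m + e)%N by exists (n - d - m)%N; lia.
rewrite ne !big_split_ord /= big1 ?add0r; last first.
  by move=> i _; apply: u0; have := ltn_ord i; lia.
rewrite [X in _ + X]big1 ?addr0; last first.
  by move=> i _; apply: u0; lia.
by apply: eq_bigr => i _; congr u; lia.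
Qed.

Lemma zsum_window (R : realType) (u : int -> R) (a : int) (m : nat) :
  (forall k, ~~ (a <= k < a + m%:Z) -> u k = 0) ->
  zsum u = \sum_(i < m) u (a + i%:Z).
Proof.
move=> u0.
have lim_eventually (v : nat -> R) (M : nat) : (forall i, (M <= i)%N -> v i = 0) ->
    limn (series v) = \sum_(i < M) v i.
  move=> v0; apply/cvg_lim => //.
  apply: cvg_near_cst.
  near=> n.
  have Mn : (M <= n)%N by near: n; exact: nbhs_infty_ge.
  apply/eqP; rewrite /series /= big_mkord -(subnKC Mn) big_split_ord /=.
  by rewrite [X in _ + X]big1 ?addr0// => i _; rewrite v0// leq_addr.
(* The window lies in [[- M, M)], so both one-sided series are constant from index [M] on. *)
pose M := (`|a| + m)%N.
rewrite /zsum (lim_eventually _ M); last by move=> i Mi; apply: u0; rewrite /M in Mi; lia.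
rewrite (lim_eventually _ M); last by move=> i Mi; apply: u0; rewrite /M in Mi; lia.
rewrite -(@sum_window_shift _ u a (- M%:Z) m (M + M)) //; try by rewrite /M; lia.
rewrite [RHS]big_split_ord /= [LHS]addrC; congr (_ + _).
  (* The negative half is enumerated as [- (i + 1)], that is, in reverse order. *)
  rewrite (reindex_inj rev_ord_inj) /=.
  by apply: eq_bigr => i _; congr u; have := ltn_ord i; lia.
by apply: eq_bigr => i _; congr u; lia.
Unshelve. all: by end_near. Qed.

Definition fin_zsupp (R : realType) (u : int -> R) : Prop :=
  exists M : nat, forall k : int, (M <= `|k|)%N -> u k = 0.

Lemma fin_zsupp_zsum (R : realType) (u : int -> R) (M n : nat) (a : int) :
  (forall k : int, (M <= `|k|)%N -> u k = 0) -> a <= - M%:Z -> M%:Z <= a + n%:Z ->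
  zsum u = \sum_(i < n) u (a + i%:Z).
Proof.
by move=> u0 aM Ma; apply: zsum_window => k ka; apply: u0; lia.
Qed.

Lemma fin_zsuppM (R : realType) (u v : int -> R) :
  fin_zsupp u -> fin_zsupp (fun k => u k * v k).
Proof. by move=> [M u0]; exists M => k /u0 ->; rewrite mul0r. Qed.

Lemma fin_zsupp_affine (R : realType) (u : int -> R) (a b : int) : a != 0 ->
  fin_zsupp u -> fin_zsupp (fun k => u (a * k + b)).
Proof.
move=> a0 [M u0]; exists (M + `|b|)%N => k kM; apply: u0.
have : (`|k| <= `|(a * k)%R|)%N by rewrite abszM; apply: leq_pmull; lia.
lia.
Qed.

(** One window contains all the supports; on it [zsum] is a finite sum and the two summations can be
    exchanged. *)
Lemma zsum_lin (R : realType) (n : nat) (c : nat -> R) (u : nat -> int -> R) :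
  (forall i, fin_zsupp (u i)) ->
  zsum (fun k => \sum_(i < n) c i * u i k) = \sum_(i < n) c i * zsum (u i).
Proof.
move=> fu.
have [M uM] : exists M : nat, forall i, (i < n)%N ->
    forall k : int, (M <= `|k|)%N -> u i k = 0.
  elim: n => [|n [M IH]]; first by exists 0%N.
  have [M' uM'] := fu n; exists (M + M')%N => i; rewrite ltnS leq_eqVlt.
  by move=> /orP[/eqP ->|/IH h] k kM; [apply: uM'|apply: h]; lia.
rewrite (@fin_zsupp_zsum _ _ M (M + M) (- M%:Z)); [|
  by move=> k kM; rewrite big1// => i _; rewrite (uM _ _ k)// mulr0 | lia.. ].
rewrite exchange_big /=; apply: eq_bigr => i _; rewrite -mulr_sumr; congr (_ * _).
by rewrite (@fin_zsupp_zsum _ _ M (M + M) (- M%:Z)); [|exact: uM|lia..].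
Qed.

Lemma zsum_shift (R : realType) (u : int -> R) (s : int) :
  fin_zsupp u -> zsum (fun k => u (k + s)) = zsum u.
Proof.
move=> [M u0].
rewrite (@fin_zsupp_zsum _ u M (M + M) (- M%:Z))//; [|lia..].
rewrite (@zsum_window _ _ (- M%:Z - s) (M + M)); last by move=> k ks; apply: u0; lia.
by apply: eq_bigr => i _; congr u; ring.
Qed.

Lemma zsum_parity (R : realType) (u : int -> R) : fin_zsupp u ->
  zsum u = zsum (fun k => u (2 * k)) + zsum (fun k => u (2 * k + 1)).
Proof.
move=> [M u0].
pose K := M.+1.
(* This window starts at an even index and has even length; the induction below runs over its pairs
   [2 k], [2 k + 1]. *)
rewrite (@fin_zsupp_zsum _ u K (K + K).*2 (2 * - K%:Z))//; [|
  by move=> k kM; apply: u0; lia|lia..].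
rewrite (@fin_zsupp_zsum _ _ K (K + K) (- K%:Z))//; [|
  by move=> k kM; apply: u0; lia|lia..].
rewrite (@fin_zsupp_zsum _ _ K (K + K) (- K%:Z))//; [|
  by move=> k kM; apply: u0; lia|lia..].
elim: (K + K)%N => [|n IH]; first by rewrite !big_ord0 addr0.
rewrite doubleS !big_ord_recr /= IH -!addrA; congr (_ + _).
by rewrite addrCA; congr (u _ + (_ + u _)); lia.
Qed.

(** * Spline coefficients *)

Definition rho (R : realType) : R := Num.sqrt 3 - 2.

(* The B-spline coefficients of [L4]; note that [rho] is the root of smaller modulus
   of [z ^ 2 + 4 z + 1], and that [7 - 4 sqrt 3] in [acoef] is its square. *)
Definition ccoef (R : realType) (n : int) : R := Num.sqrt 3 * rho R ^+ `|n|.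

Lemma sqrt3E (R : realType) : Num.sqrt (3 : R) = rho R + 2.
Proof. by rewrite /rho subrK. Qed.

(** Handing this relation to [ring] and [field] makes the coefficient identities polynomial
    identities in [rho] and a power of it. *)
Lemma rho2 (R : realType) : rho R ^+ 2 = - 4 * rho R - 1.
Proof.
have : Num.sqrt (3 : R) ^+ 2 = 3 by rewrite sqr_sqrtr.
rewrite sqrt3E => h; lra.
Qed.

(** The bases in the two branches of [acoef] are [rho] and its square, or their inverses; a single
    formula in the absolute value of [n] shows the symmetry. *)
Lemma acoefE (R : realType) (n : int) :
  acoef R n = Num.sqrt 3 * (2 * rho R ^+ `|n| + 2^-1 * (rho R ^+ 2) ^+ `|n|).
Proof.
have r2 := rho2 R.
have r0 : rho R != 0.
  by apply/eqP => r0; move: r2; rewrite r0; lra.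
have rV : - 2 - Num.sqrt 3 = (rho R)^-1.
  apply: (mulIf r0); rewrite mulVf// sqrt3E; ring: r2.
have rV2 : 7 + 4 * Num.sqrt 3 = (rho R ^+ 2)^-1.
  apply: (mulIf (expf_neq0 2 r0)); rewrite mulVf ?expf_neq0// sqrt3E; ring: r2.
rewrite /acoef /=; case: ifPn => n1; last first.
  have [m ->] : exists m : nat, n = m.+2%:Z by exists (`|n| - 2)%N; lia.
  rewrite (_ : m.+2%:Z - 1 = m.+1%:Z); last by lia.
  rewrite -!exprnP.
  rewrite (_ : - 2 + Num.sqrt 3 = rho R); last by rewrite sqrt3E; ring.
  rewrite (_ : 7 - 4 * Num.sqrt 3 = rho R ^+ 2); last by rewrite sqrt3E r2; ring.
  rewrite absz_nat !(exprS _ m.+1) sqrt3E.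
  set A := rho R ^+ m.+1; set B := (rho R ^+ 2) ^+ m.+1.
  by field: r2.
rewrite rV rV2 !exprz_inv.
have [m ->] : exists m : nat, n = 1 - m%:Z by exists `|n - 1|%N; lia.
rewrite (_ : - (1 - m%:Z - 1) = m%:Z); last by lia.
rewrite -!exprnP.
(* The index [n = 1] belongs to this branch although it is positive; for all others the absolute
   value is the predecessor of the old [m]. *)
case: m n1 => [|m] _.
  rewrite subr0 /= !expr0 !expr1 sqrt3E; by field: r2.
rewrite (_ : `|1 - m.+1%:Z|%N = m); last by lia.
rewrite !exprS sqrt3E.
set A := rho R ^+ m; set B := (rho R ^+ 2) ^+ m.
by field: r2.
Qed.

Lemma ccoefN (R : realType) (n : int) : ccoef R (- n) = ccoef R n.
Proof. by rewrite /ccoef abszN. Qed.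

Lemma acoefN (R : realType) (n : int) : acoef R (- n) = acoef R n.
Proof. by rewrite !acoefE abszN. Qed.

(** The exponent is a separate [n], so that [lia] can settle absolute values of symbolic indices. *)
Lemma ccoef_nat (R : realType) (n : nat) (z : int) :
  `|z|%N = n -> ccoef R z = (rho R + 2) * rho R ^+ n.
Proof. by move=> <-; rewrite -sqrt3E. Qed.

Lemma acoef_nat (R : realType) (n : nat) (z : int) :
  `|z|%N = n -> acoef R z = (rho R + 2) * (2 * rho R ^+ n + 2^-1 * (rho R ^+ n) ^+ 2).
Proof. by move=> <-; rewrite acoefE sqrt3E exprAC. Qed.

(* The next four identities are the two-scale relations of [L4], read on
   B-spline coefficients. *)
Lemma ccoef_even (R : realType) (q : int) :
  48 * ccoef R (2 * q) = 6 * (ccoef R (q + 1) + 6 * ccoef R q + ccoef R (q - 1))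
    + 6^-1 * (acoef R (q - 2) + 24 * acoef R (q - 1) + 46 * acoef R q
              + 24 * acoef R (q + 1) + acoef R (q + 2)).
Proof.
(* Both coefficient sequences are even, so [q] may be replaced by [- q]. *)
wlog q0 : q / 0 <= q => [hw|].
  have [/hw//|q0] := lerP 0 q.
  have := hw (- q); rewrite oppr_ge0 (ltW q0) => /(_ isT).
  rewrite mulrN (_ : - q + 1 = - (q - 1)); last by ring.
  rewrite (_ : - q - 1 = - (q + 1)); last by ring.
  rewrite (_ : - q + 2 = - (q - 2)); last by ring.
  rewrite (_ : - q - 2 = - (q + 2)); last by ring.
  by rewrite !ccoefN !acoefN => ->; ring.
have r2 := rho2 R.
(* The indices go down to [q - 2]: only from [q = 2] on are all absolute values linear in [q]. *)
have [->|q0'] := eqVneq q 0.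
  rewrite ?(@ccoef_nat _ 0 (2 * 0))// ?(@ccoef_nat _ 1 (0 + 1))//
    ?(@ccoef_nat _ 0 (0))// ?(@ccoef_nat _ 1 (0 - 1))//.
  rewrite ?(@acoef_nat _ 2 (0 - 2))// ?(@acoef_nat _ 1 (0 - 1))// ?(@acoef_nat _ 0 (0))//
    ?(@acoef_nat _ 1 (0 + 1))// ?(@acoef_nat _ 2 (0 + 2))//.
  by field: r2.
have [->|q1] := eqVneq q 1.
  rewrite ?(@ccoef_nat _ 2 (2 * 1))// ?(@ccoef_nat _ 2 (1 + 1))//
    ?(@ccoef_nat _ 1 (1))// ?(@ccoef_nat _ 0 (1 - 1))//.
  rewrite ?(@acoef_nat _ 1 (1 - 2))// ?(@acoef_nat _ 0 (1 - 1))// ?(@acoef_nat _ 1 (1))//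
    ?(@acoef_nat _ 2 (1 + 1))// ?(@acoef_nat _ 3 (1 + 2))//.
  by field: r2.
have [m ->] : exists m : nat, q = m.+2%:Z by exists (`|q| - 2)%N; lia.
rewrite (@ccoef_nat _ (m + m + 4)%N); last by lia.
rewrite (@ccoef_nat _ (m + 3)%N); last by lia.
rewrite (@ccoef_nat _ (m + 2)%N); last by lia.
rewrite (@ccoef_nat _ (m + 1)%N); last by lia.
rewrite (@acoef_nat _ m); last by lia.
rewrite (@acoef_nat _ (m + 1)%N); last by lia.
rewrite (@acoef_nat _ (m + 2)%N); last by lia.
rewrite (@acoef_nat _ (m + 3)%N); last by lia.
rewrite (@acoef_nat _ (m + 4)%N); last by lia.
rewrite !exprD; set A := rho R ^+ m.
by field: r2.
Qed.

Lemma ccoef_odd (R : realType) (q : int) :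
  48 * ccoef R (2 * q + 1) = 24 * (ccoef R q + ccoef R (q + 1))
    - 2 / 3 * (acoef R (q - 1) + 23 * acoef R q + 23 * acoef R (q + 1)
               + acoef R (q + 2)).
Proof.
wlog q0 : q / 0 <= q => [hw|].
  have [/hw//|q0] := lerP 0 q.
  (* The reflection of [q] to [- q - 1] changes the sign of [2 * q + 1]. *)
  have := hw (- q - 1); rewrite (_ : (0 <= - q - 1) = true); last by lia.
  move=> /(_ isT).
  rewrite (_ : 2 * (- q - 1) + 1 = - (2 * q + 1)); last by ring.
  rewrite (_ : - q - 1 - 1 = - (q + 2)); last by ring.
  rewrite (_ : - q - 1 + 1 = - q); last by ring.
  rewrite (_ : - q - 1 + 2 = - (q - 1)); last by ring.
  rewrite (_ : - q - 1 = - (q + 1)); last by ring.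
  by rewrite !ccoefN !acoefN => ->; ring.
have r2 := rho2 R.
have [->|q0'] := eqVneq q 0.
  rewrite ?(@ccoef_nat _ 1 (2 * 0 + 1))// ?(@ccoef_nat _ 0 (0))// ?(@ccoef_nat _ 1 (0 + 1))//.
  rewrite ?(@acoef_nat _ 1 (0 - 1))// ?(@acoef_nat _ 0 (0))//
    ?(@acoef_nat _ 1 (0 + 1))// ?(@acoef_nat _ 2 (0 + 2))//.
  by field: r2.
have [m ->] : exists m : nat, q = m.+1%:Z by exists (`|q| - 1)%N; lia.
rewrite (@ccoef_nat _ (m + m + 3)%N); last by lia.
rewrite (@ccoef_nat _ (m + 1)%N); last by lia.
rewrite (@ccoef_nat _ (m + 2)%N); last by lia.
rewrite (@acoef_nat _ m); last by lia.
rewrite (@acoef_nat _ (m + 1)%N); last by lia.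
rewrite (@acoef_nat _ (m + 2)%N); last by lia.
rewrite (@acoef_nat _ (m + 3)%N); last by lia.
rewrite !exprD; set A := rho R ^+ m.
by field: r2.
Qed.

Lemma ccoef_even_acoef (R : realType) (q : int) :
  9 * ccoef R (2 * q) = acoef R (q - 1) + 4 * acoef R q + acoef R (q + 1).
Proof.
wlog q0 : q / 0 <= q => [hw|].
  have [/hw//|q0] := lerP 0 q.
  have := hw (- q); rewrite oppr_ge0 (ltW q0) => /(_ isT).
  rewrite mulrN (_ : - q + 1 = - (q - 1)); last by ring.
  rewrite (_ : - q - 1 = - (q + 1)); last by ring.
  by rewrite !ccoefN !acoefN => ->; ring.
have r2 := rho2 R.
have [->|q0'] := eqVneq q 0.
  rewrite ?(@ccoef_nat _ 0 (2 * 0))//.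
  rewrite ?(@acoef_nat _ 1 (0 - 1))// ?(@acoef_nat _ 0 (0))// ?(@acoef_nat _ 1 (0 + 1))//.
  by field: r2.
have [m ->] : exists m : nat, q = m.+1%:Z by exists (`|q| - 1)%N; lia.
rewrite (@ccoef_nat _ (m + m + 2)%N); last by lia.
rewrite (@acoef_nat _ m); last by lia.
rewrite (@acoef_nat _ (m + 1)%N); last by lia.
rewrite (@acoef_nat _ (m + 2)%N); last by lia.
rewrite !exprD; set A := rho R ^+ m.
by field: r2.
Qed.

Lemma ccoef_odd_acoef (R : realType) (q : int) :
  36 * ccoef R (2 * q + 1) =
  - (acoef R (q - 1) + 5 * acoef R q + 5 * acoef R (q + 1) + acoef R (q + 2)).
Proof.
wlog q0 : q / 0 <= q => [hw|].
  have [/hw//|q0] := lerP 0 q.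
  have := hw (- q - 1); rewrite (_ : (0 <= - q - 1) = true); last by lia.
  move=> /(_ isT).
  rewrite (_ : 2 * (- q - 1) + 1 = - (2 * q + 1)); last by ring.
  rewrite (_ : - q - 1 - 1 = - (q + 2)); last by ring.
  rewrite (_ : - q - 1 + 1 = - q); last by ring.
  rewrite (_ : - q - 1 + 2 = - (q - 1)); last by ring.
  rewrite (_ : - q - 1 = - (q + 1)); last by ring.
  by rewrite !ccoefN !acoefN => ->; ring.
have r2 := rho2 R.
have [->|q0'] := eqVneq q 0.
  rewrite ?(@ccoef_nat _ 1 (2 * 0 + 1))//.
  rewrite ?(@acoef_nat _ 1 (0 - 1))// ?(@acoef_nat _ 0 (0))//
    ?(@acoef_nat _ 1 (0 + 1))// ?(@acoef_nat _ 2 (0 + 2))//.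
  by field: r2.
have [m ->] : exists m : nat, q = m.+1%:Z by exists (`|q| - 1)%N; lia.
rewrite (@ccoef_nat _ (m + m + 3)%N); last by lia.
rewrite (@acoef_nat _ m); last by lia.
rewrite (@acoef_nat _ (m + 1)%N); last by lia.
rewrite (@acoef_nat _ (m + 2)%N); last by lia.
rewrite (@acoef_nat _ (m + 3)%N); last by lia.
rewrite !exprD; set A := rho R ^+ m.
by field: r2.
Qed.

(** Off 0 this is the quadratic equation of [rho]. As the cubic B-spline has the values 1/6, 4/6,
    1/6 at its interior knots, it says that [L4] is 1 at 0 and 0 at the other integers. *)
Lemma ccoef_tridiag (R : realType) (q : int) :
  ccoef R (q - 1) + 4 * ccoef R q + ccoef R (q + 1) = 6 * (q == 0)%:R.
Proof.
wlog q0 : q / 0 <= q => [hw|].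
  have [/hw//|q0] := lerP 0 q.
  have := hw (- q); rewrite oppr_ge0 (ltW q0) => /(_ isT).
  rewrite (_ : - q + 1 = - (q - 1)); last by ring.
  rewrite (_ : - q - 1 = - (q + 1)); last by ring.
  by rewrite !ccoefN oppr_eq0 => <-; ring.
have r2 := rho2 R.
have [->|q0'] := eqVneq q 0.
  rewrite ?(@ccoef_nat _ 1 (0 - 1))// ?(@ccoef_nat _ 0 (0))// ?(@ccoef_nat _ 1 (0 + 1))//.
  by rewrite mulr1n; ring: r2.
have [m ->] : exists m : nat, q = m.+1%:Z by exists (`|q| - 1)%N; lia.
rewrite (@ccoef_nat _ m); last by lia.
rewrite (@ccoef_nat _ (m + 1)%N); last by lia.
rewrite (@ccoef_nat _ (m + 2)%N); last by lia.
rewrite !exprD /=; set A := rho R ^+ m.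
by rewrite mulr0n; ring: r2.
Qed.

(** * Two-scale relations *)

Lemma tpow_eq0 (R : realType) (k : nat) (x : R) : x <= 0 -> tpow k.+1 x = 0.
Proof. by move=> x0; rewrite /tpow max_r// expr0n. Qed.

Lemma tpow_id (R : realType) (k : nat) (x : R) : 0 <= x -> tpow k x = x ^+ k.
Proof. by move=> x0; rewrite /tpow max_l. Qed.

Lemma bspline4_out (R : realType) (x : R) : ~~ (0 < x < 4) -> bspline 4 x = 0.
Proof.
rewrite bspline4E negb_and -!leNgt => /orP[x0|x4].
  by rewrite !tpow_eq0; [ring|lra..].
(* From 4 on no power is truncated, and the fourth difference of a cubic vanishes. *)
by rewrite !tpow_id; [ring|lra..].
Qed.

Lemma bspline4_piece (R : realType) (t : R) : 0 <= t <= 1 ->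
  [/\ bspline 4 t = t ^+ 3 / 6,
      bspline 4 (t + 1) = (1 + 3 * t + 3 * t ^+ 2 - 3 * t ^+ 3) / 6,
      bspline 4 (t + 2) = (4 - 6 * t ^+ 2 + 3 * t ^+ 3) / 6 &
      bspline 4 (t + 3) = (1 - t) ^+ 3 / 6].
Proof.
move=> /andP[t0 t1]; rewrite !bspline4E; split.
- by rewrite tpow_id// !tpow_eq0; [field|lra..].
- by rewrite !(@tpow_id _ 3 (t + 1), @tpow_id _ 3 (t + 1 - 1)) ?tpow_eq0; [field|lra..].
- by rewrite !(@tpow_id _ 3 (t + 2), @tpow_id _ 3 (t + 2 - 1),
    @tpow_id _ 3 (t + 2 - 2)) ?tpow_eq0; [field|lra..].
- by rewrite (@tpow_eq0 _ 2 (t + 3 - 4)) ?tpow_id; [field|lra..].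
Qed.

Lemma L4_local (R : realType) (p : int) (t : R) : 0 <= t < 1 ->
  L4 (p%:~R + t) = ccoef R (p - 1) * bspline 4 (t + 3) + ccoef R p * bspline 4 (t + 2)
    + ccoef R (p + 1) * bspline 4 (t + 1) + ccoef R (p + 2) * bspline 4 t.
Proof.
move=> /andP[t0 t1]; rewrite /L4.
(* Generalizing [bspline 4] keeps simplification from unfolding it into iterated integrals. *)
have := @bspline4_out R; generalize (@bspline R 4) => B B_out.
rewrite (@zsum_window _ _ (p - 1) 4); last first.
  move=> k kp; rewrite B_out ?mulr0//; apply: contra kp => /andP[h1 h2].
  have : (p - 2)%:~R < k%:~R :> R by rewrite intrB; lra.
  have : k%:~R < (p + 3)%:~R :> R by rewrite intrD; lra.
  by rewrite !ltr_int; lia.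
have cE (n : int) : (-1) ^ n * Num.sqrt 3 * (2 - Num.sqrt 3) ^+ `|n|%N = ccoef R n.
  rewrite /ccoef (_ : (-1 : R) ^ n = (-1) ^+ `|n|%N); last first.
    case: n => n /=; first by rewrite -exprnP.
    by rewrite [LHS]/exprz -exprVn invrN1.
  rewrite mulrAC mulrC; congr (_ * _); rewrite -exprMn; congr (_ ^+ _).
  by rewrite /rho; ring.
rewrite !big_ord_recr big_ord0 /= add0r !cE addr0.
rewrite (_ : p - 1 + 1 = p); last by ring.
rewrite (_ : p - 1 + 2 = p + 1); last by ring.
rewrite (_ : p - 1 + 3 = p + 2); last by ring.
congr (_ * B _ + _ * B _ + _ * B _ + _ * B _);
  rewrite ?intrD ?intrB; ring.
Qed.

Lemma vspline_out (R : realType) (t : R) : ~~ (0 < t < 3) -> vspline t = 0.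
Proof.
rewrite negb_and -!leNgt /vspline => /orP[t0|t3].
  have [->|tn0] := eqVneq t 0.
    by rewrite (_ : (0 <= (0 : R) <= 1 / 2) = true) ?expr0n ?mulr0//; lra.
  do !(case: ifP => /= ?; first by exfalso; lra).
  by rewrite mulr0.
have [->|tn3] := eqVneq t 3.
  do !(case: ifP => /= ?; first by (exfalso; lra) || ring).
  by rewrite mulr0.
do !(case: ifP => /= ?; first by exfalso; lra).
by rewrite mulr0.
Qed.

(** The knots of [vspline] are half-integers, so each unit interval is cut in two. At [t = 0] the
    arguments [t + 1] and [t + 2] fall into the preceding pieces, which agree there by
    continuity. *)
Lemma vspline_piece_left (R : realType) (t : R) : 0 <= t <= 2^-1 ->
  [/\ vspline t = 36^-1 * t ^+ 3,
      vspline (t + 1) = 36^-1 * (- 3 * t - 9 * t ^+ 2 + 16 * t ^+ 3) &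
      vspline (t + 2) = 36^-1 * (3 * t - 9 * t ^+ 2 + 7 * t ^+ 3)].
Proof.
move=> ht; have [->|tn0] := eqVneq t 0.
  split; rewrite /vspline; do !(case: ifP => /= ?; first by (exfalso; lra) || ring);
  ring.
split; rewrite /vspline.
- by do !(case: ifP => /= ?; first by (exfalso; lra) || ring); exfalso; lra.
- by do !(case: ifP => /= ?; first by (exfalso; lra) || ring); exfalso; lra.
- by do !(case: ifP => /= ?; first by (exfalso; lra) || ring); exfalso; lra.
Qed.

Lemma vspline_piece_right (R : realType) (t : R) : 2^-1 <= t <= 1 ->
  [/\ vspline t = 36^-1 * (1 - 6 * t + 12 * t ^+ 2 - 7 * t ^+ 3),
      vspline (t + 1) =
        36^-1 * (4 - 27 * t + 39 * t ^+ 2 - 16 * t ^+ 3) &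
      vspline (t + 2) = 36^-1 * (1 - t) ^+ 3].
Proof.
move=> ht; have [->|tn0] := eqVneq t 2^-1.
  split; rewrite /vspline; do !(case: ifP => /= ?; first by (exfalso; lra) || field);
  exfalso; lra.
split; rewrite /vspline.
- by do !(case: ifP => /= ?; first by (exfalso; lra) || ring); exfalso; lra.
- by do !(case: ifP => /= ?; first by (exfalso; lra) || ring); exfalso; lra.
- by do !(case: ifP => /= ?; first by (exfalso; lra) || ring); exfalso; lra.
Qed.

(* Every [s_{j,k}] is a dilate and translate of this function. *)
Definition mother (R : realType) (y : R) : R :=
  zsum (fun n : int => acoef R n * vspline (y - n%:~R)).

Lemma mother_local (R : realType) (p : int) (t : R) : 0 <= t < 1 ->
  mother (p%:~R + t) = acoef R (p - 2) * vspline (t + 2)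
    + acoef R (p - 1) * vspline (t + 1) + acoef R p * vspline t.
Proof.
move=> /andP[t0 t1]; rewrite /mother (@zsum_window _ _ (p - 2) 3); last first.
  move=> n np; rewrite vspline_out ?mulr0//; apply: contra np => /andP[h1 h2].
  have : (p - 3)%:~R < n%:~R :> R by rewrite intrB; lra.
  have : n%:~R < (p + 1)%:~R :> R by rewrite intrD; lra.
  by rewrite !ltr_int; lia.
rewrite !big_ord_recr big_ord0 /= add0r addr0.
rewrite (_ : p - 2 + 1 = p - 1); last by ring.
rewrite (_ : p - 2 + 2 = p); last by ring.
generalize (@vspline R) => V.
congr (_ * V _ + _ * V _ + _ * V _); rewrite ?intrD ?intrB; ring.
Qed.

(** A product of equations serves as one rewriting rule; it also brings indices to the forms [2 * q]
    and [2 * q + 1] of the coefficient identities. *)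
Lemma index_shifts (p : int) : (p - 1 - 1 = p - 2) * (p - 1 + 1 = p) * (p - 1 + 2 = p + 1)
  * (p + 1 - 1 = p) * (p + 1 - 2 = p - 1) * (p + 1 + 1 = p + 2) * (p + 1 + 2 = p + 3)
  * (p + 2 - 1 = p + 1) * (p + 2 - 2 = p) * (p + 3 - 1 = p + 2) * (p + 3 - 2 = p + 1)
  * (2 * p - 1 = 2 * (p - 1) + 1) * (2 * p + 2 = 2 * (p + 1))
  * (2 * p + 1 - 1 = 2 * p) * (2 * p + 1 + 1 = 2 * (p + 1))
  * (2 * p + 1 + 2 = 2 * (p + 1) + 1).
Proof. by do !split; ring. Qed.

Lemma floor_decomp (R : realType) (y : R) :
  exists p : int, exists2 t : R, 0 <= t < 1 & y = p%:~R + t.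
Proof.
exists (Num.floor y), (y - (Num.floor y)%:~R); last by ring.
have := floor_le y; have := floorD1_gt y; rewrite intrD => h1 h2.
by apply/andP; split; lra.
Qed.

Lemma L4_two_scale_even (R : realType) (y : R) :
  L4 (2 * y) = L4 y + 6^-1 * (mother y + 23 * mother (y + 1) + 23 * mother (y + 2)
                              + mother (y + 3)).
Proof.
have [p [t t01 ->]] := floor_decomp y.
have -> : p%:~R + t + 1 = (p + 1)%:~R + t :> R by rewrite intrD; ring.
have -> : p%:~R + t + 2 = (p + 2)%:~R + t :> R by rewrite intrD; ring.
have -> : p%:~R + t + 3 = (p + 3)%:~R + t :> R by rewrite intrD; ring.
rewrite !mother_local// [in RHS]L4_local//.
have tle1 : 0 <= t <= 1 by lra.
have [-> -> -> ->] := bspline4_piece tle1.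
(* The factor 48 makes the left-hand sides of [ccoef_even] and [ccoef_odd] appear. *)
have ev q : ccoef R (2 * q) = 48^-1 * (48 * ccoef R (2 * q)) by field.
have od q : ccoef R (2 * q + 1) = 48^-1 * (48 * ccoef R (2 * q + 1)) by field.
have [th|th] := ltrP t 2^-1.
  have -> : 2 * (p%:~R + t) = (2 * p)%:~R + 2 * t :> R by rewrite intrM; ring.
  have t2 : 0 <= 2 * t < 1 by lra.
  have t2' : 0 <= 2 * t <= 1 by lra.
  rewrite L4_local//; have [-> -> -> ->] := bspline4_piece t2'.
  have thh : 0 <= t <= 2^-1 by lra.
  have [-> -> ->] := vspline_piece_left thh.
  rewrite !(index_shifts p) (ev p) (ev (p + 1)) (od p) (od (p - 1)).
  rewrite !ccoef_even !ccoef_odd !(index_shifts p).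
  by field.
have -> : 2 * (p%:~R + t) = (2 * p + 1)%:~R + (2 * t - 1) :> R.
  by rewrite intrD intrM; ring.
have t2 : 0 <= 2 * t - 1 < 1 by lra.
have t2' : 0 <= 2 * t - 1 <= 1 by lra.
rewrite L4_local//; have [-> -> -> ->] := bspline4_piece t2'.
have thh : 2^-1 <= t <= 1 by lra.
have [-> -> ->] := vspline_piece_right thh.
rewrite !(index_shifts p) (ev p) (ev (p + 1)) (od p) (od (p + 1)).
rewrite !ccoef_even !ccoef_odd !(index_shifts p).
by field.
Qed.

(** The right-hand side has no [L4] term, hence the identities that express [ccoef] through [acoef]
    alone. *)
Lemma L4_two_scale_odd (R : realType) (y : R) :
  L4 (2 * y - 1) = - (6^-1 * (8 * mother y + 32 * mother (y + 1) + 8 * mother (y + 2))).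
Proof.
have [p [t t01 ->]] := floor_decomp y.
have -> : p%:~R + t + 1 = (p + 1)%:~R + t :> R by rewrite intrD; ring.
have -> : p%:~R + t + 2 = (p + 2)%:~R + t :> R by rewrite intrD; ring.
rewrite !mother_local//.
have ev q : ccoef R (2 * q) = 9^-1 * (9 * ccoef R (2 * q)) by field.
have od q : ccoef R (2 * q + 1) = 36^-1 * (36 * ccoef R (2 * q + 1)) by field.
have [th|th] := ltrP t 2^-1.
  have -> : 2 * (p%:~R + t) - 1 = (2 * p - 1)%:~R + 2 * t :> R.
    by rewrite intrB intrM; ring.
  have t2 : 0 <= 2 * t < 1 by lra.
  have t2' : 0 <= 2 * t <= 1 by lra.
  rewrite L4_local//; have [-> -> -> ->] := bspline4_piece t2'.
  have thh : 0 <= t <= 2^-1 by lra.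
  have [-> -> ->] := vspline_piece_left thh.
  have -> : 2 * p - 1 - 1 = 2 * (p - 1) by ring.
  have -> : 2 * p - 1 + 1 = 2 * p by ring.
  have -> : 2 * p - 1 + 2 = 2 * p + 1 by ring.
  rewrite !(index_shifts p) (ev p) (ev (p - 1)) (od p) (od (p - 1)).
  rewrite !ccoef_even_acoef !ccoef_odd_acoef !(index_shifts p).
  by field.
have -> : 2 * (p%:~R + t) - 1 = (2 * p)%:~R + (2 * t - 1) :> R.
  by rewrite intrM; ring.
have t2 : 0 <= 2 * t - 1 < 1 by lra.
have t2' : 0 <= 2 * t - 1 <= 1 by lra.
rewrite L4_local//; have [-> -> -> ->] := bspline4_piece t2'.
have thh : 2^-1 <= t <= 1 by lra.
have [-> -> ->] := vspline_piece_right thh.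
rewrite !(index_shifts p) (ev p) (ev (p + 1)) (od p) (od (p - 1)).
rewrite !ccoef_even_acoef !ccoef_odd_acoef !(index_shifts p).
by field.
Qed.

(* Splitting the left-hand side by the parity of [k] and resumming by parts
   produces the weights of [lam], in terms of samples of [f]. *)
Lemma zsum_two_scale (R : realType) (phi mu : R -> R) (F : int -> R) (y : R) :
  (forall z, phi (2 * z) =
    phi z + 6^-1 * (mu z + 23 * mu (z + 1) + 23 * mu (z + 2) + mu (z + 3))) ->
  (forall z, phi (2 * z - 1) =
    - (6^-1 * (8 * mu z + 32 * mu (z + 1) + 8 * mu (z + 2)))) ->
  fin_zsupp F ->
  zsum (fun k => F k * phi (2 * y - k%:~R)) =
  zsum (fun k => F (2 * k) * phi (y - k%:~R)) +
  zsum (fun k => (\sum_(i < 7) [:: 1; -8; 23; -32; 23; -8; 1]`_i / 6 *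
    F (2 * k + i%:Z)) * mu (y - k%:~R)).
Proof.
move=> phi_even phi_odd finF.
have fin2 (e : int) : fin_zsupp (fun k => F (2 * k + e)) by exact: fin_zsupp_affine.
(* Normal form of the [mu] series: [e] is the parity of the sample index and [u] the shift of [mu];
   reindexing trades a sample offset [e + 2 u] for it. *)
pose P (e : int) (u : nat) := zsum (fun k => F (2 * k + e) * mu (y - k%:~R + u%:R)).
have shiftP (i e : int) (u : nat) : i = e + 2 * u%:Z ->
    zsum (fun k => F (2 * k + i) * mu (y - k%:~R)) = P e u.
  move=> ->; have := @zsum_shift _ (fun k => F (2 * k + e) * mu (y - k%:~R + u%:R)) u%:Z.
  rewrite -/(P e u) => <-; last exact: (fin_zsuppM _ (fin2 e)).
  congr zsum; apply: funext => k; congr (F _ * mu _); first by ring.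
  by rewrite intrD; ring.
rewrite zsum_parity; last exact: fin_zsuppM.
pose cs : seq R := [:: 1; 6^-1; 23 / 6; 23 / 6; 6^-1].
pose gs : seq (R -> R) := [:: phi; fun z => mu (z + 0%:R); fun z => mu (z + 1%:R);
  fun z => mu (z + 2%:R); fun z => mu (z + 3%:R)].
have -> : zsum (fun k => F (2 * k) * phi (2 * y - (2 * k)%:~R)) =
    zsum (fun k => \sum_(i < 5) cs`_i *
      (F (2 * k + 0) * nth (fun=> 0) gs i (y - k%:~R))).
  congr zsum; apply: funext => k.
  rewrite !big_ord_recr big_ord0 /= !addr0.
  rewrite (_ : 2 * y - (2 * k)%:~R = 2 * (y - k%:~R)); last by rewrite intrM; ring.
  by rewrite phi_even; ring.
rewrite (@zsum_lin _ _ (fun i => cs`_i)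
  (fun i k => F (2 * k + 0) * nth (fun=> 0) gs i (y - k%:~R))); last first.
  by move=> i; exact: (fin_zsuppM _ (fin2 0)).
pose ds : seq R := [:: - 8 / 6; - 32 / 6; - 8 / 6].
pose hs : seq (R -> R) := [:: fun z => mu (z + 0%:R); fun z => mu (z + 1%:R);
  fun z => mu (z + 2%:R)].
have -> : zsum (fun k => F (2 * k + 1) * phi (2 * y - (2 * k + 1)%:~R)) =
    zsum (fun k => \sum_(i < 3) ds`_i *
      (F (2 * k + 1) * nth (fun=> 0) hs i (y - k%:~R))).
  congr zsum; apply: funext => k.
  rewrite !big_ord_recr big_ord0 /= !addr0.
  rewrite (_ : 2 * y - (2 * k + 1)%:~R = 2 * (y - k%:~R) - 1); last first.
    by rewrite intrD intrM; ring.
  by rewrite phi_odd; field.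
rewrite (@zsum_lin _ _ (fun i => ds`_i)
  (fun i k => F (2 * k + 1) * nth (fun=> 0) hs i (y - k%:~R))); last first.
  by move=> i; exact: (fin_zsuppM _ (fin2 1)).
pose ws : seq R := [:: 1; -8; 23; -32; 23; -8; 1].
have -> : zsum (fun k => (\sum_(i < 7) ws`_i / 6 * F (2 * k + i%:Z)) * mu (y - k%:~R)) =
    zsum (fun k => \sum_(i < 7) (ws`_i / 6) *
      (F (2 * k + i%:Z) * mu (y - k%:~R))).
  congr zsum; apply: funext => k; rewrite mulr_suml.
  by apply: eq_bigr => i _; rewrite -mulrA.
rewrite (@zsum_lin _ _ (fun i => ws`_i / 6)
  (fun i k => F (2 * k + i%:Z) * mu (y - k%:~R))); last first.
  by move=> i; exact: (fin_zsuppM _ (fin2 i%:Z)).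
(* The even samples carry the weights 1, 23, 23, 1 and the odd ones -8, -32, -8, all over 6; after
   normalization the claim is linear in the series. *)
rewrite !big_ord_recr !big_ord0 /=.
rewrite -!/(P _ 0%N) -!/(P _ 1%N) -!/(P _ 2%N) -!/(P _ 3%N).
rewrite (shiftP 0%:Z 0 0%N)// (shiftP 1%:Z 1 0%N)// (shiftP 2%:Z 0 1%N)//.
rewrite (shiftP 3%:Z 1 1%N)// (shiftP 4%:Z 0 2%N)// (shiftP 5%:Z 1 2%N)//.
rewrite (shiftP 6%:Z 0 3%N)//.
have -> : zsum (fun k => F (2 * k + 0) * phi (y - k%:~R)) =
    zsum (fun k => F (2 * k) * phi (y - k%:~R)).
  by congr zsum; apply: funext => k; rewrite addr0.
by field.
Qed.

(* The cardinal cubic spline interpolant of [f] on the grid [2 ^- N * Z]. *)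
Definition interp (R : realType) (N : nat) (f : R -> R) (x : R) : R :=
  zsum (fun k : int => f (k%:~R / 2 ^+ N) * L4 (2 ^+ N * x - k%:~R)).

(** With a natural bound [A], the samples at scale [2 ^- N] vanish from index [A * 2 ^ N] on. *)
Definition zero_outside (R : realType) (f : R -> R) : Prop :=
  exists A : nat, forall x, A%:R <= `|x| -> f x = 0.

Lemma fin_zsupp_sample (R : realType) (f : R -> R) (N : nat) :
  zero_outside f -> fin_zsupp (fun k : int => f (k%:~R / 2 ^+ N)).
Proof.
move=> [A fA]; exists (A * 2 ^ N)%N => k kA; apply: fA.
rewrite normrM normfV [`|2 ^+ N|]ger0_norm ?exprn_ge0// ler_pdivlMr ?exprn_gt0//.
have -> : `|k%:~R| = `|k|%N%:R :> R by rewrite -intr_norm -abszE.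
by rewrite -natrX -natrM ler_nat.
Qed.

(** The weights are the convolution of 1, -4, 1 with the weights 1, -4, 6, -4, 1 of the fourth
    difference. *)
Lemma lamE (R : realType) (f : R -> R) (N : nat) (k : int) :
  lam f N k = \sum_(i < 7) [:: 1; -8; 23; -32; 23; -8; 1]`_i / 6 *
    f ((2 * k + i%:Z)%:~R / 2 ^+ N.+1).
Proof.
pose F (n : int) := f (n%:~R / 2 ^+ N.+1).
have fE (m : int) : fdiff 4 (2 ^- N.+1) f (m%:~R / 2 ^+ N.+1) =
    F m - 4 * F (m + 1%:Z) + 6 * F (m + 2%:Z) - 4 * F (m + 3%:Z) + F (m + 4%:Z).
  have e (l : nat) : f (m%:~R / 2 ^+ N.+1 + 2 ^- N.+1 * l%:R) = F (m + l%:Z).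
    by rewrite /F intrD mulrDl [2 ^- _ * _]mulrC.
  rewrite /fdiff !big_ord_recr big_ord0 !e /= addr0.
  rewrite (_ : (4 - 0)%N = 4%N)// (_ : (4 - 1)%N = 3%N)// (_ : (4 - 2)%N = 2%N)//.
  rewrite (_ : (4 - 3)%N = 1%N)// (_ : (4 - 4)%N = 0%N)//.
  rewrite (_ : 'C(4, 0) = 1%N)// (_ : 'C(4, 1) = 4%N)// (_ : 'C(4, 2) = 6%N)//.
  by rewrite (_ : 'C(4, 3) = 4%N)// (_ : 'C(4, 4) = 1%N)//; ring.
rewrite /lam /= !fE !big_ord_recr big_ord0 /= -!/(F _) !addr0.
have -> : 2 * k + 1 + 1%:Z = 2 * k + 2%:Z by ring.
have -> : 2 * k + 1 + 2%:Z = 2 * k + 3%:Z by ring.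
have -> : 2 * k + 1 + 3%:Z = 2 * k + 4%:Z by ring.
have -> : 2 * k + 1 + 4%:Z = 2 * k + 5%:Z by ring.
have -> : 2 * k + 2 + 1%:Z = 2 * k + 3%:Z by ring.
have -> : 2 * k + 2 + 2%:Z = 2 * k + 4%:Z by ring.
have -> : 2 * k + 2 + 3%:Z = 2 * k + 5%:Z by ring.
have -> : 2 * k + 2 + 4%:Z = 2 * k + 6%:Z by ring.
by field.
Qed.

Lemma interpS (R : realType) (f : R -> R) (N : nat) (x : R) : zero_outside f ->
  interp N.+1 f x = interp N f x + zsum (fun k : int => lam f N k * sjk N k x).
Proof.
move=> f_out; have := @zsum_two_scale R (@L4 R) (@mother R)
  (fun k => f (k%:~R / 2 ^+ N.+1)) (2 ^+ N * x)
  (@L4_two_scale_even R) (@L4_two_scale_odd R) (fin_zsupp_sample N.+1 f_out).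
have -> : 2 * (2 ^+ N * x) = 2 ^+ N.+1 * x by rewrite exprS mulrA.
(* The even samples of the finer grid are the samples of the coarser one. *)
have e2 k : (2 * k)%:~R / 2 ^+ N.+1 = k%:~R / 2 ^+ N :> R.
  by rewrite intrM exprS invfM mulrACA divff ?mul1r// pnatr_eq0.
under [in X in _ = X + _ -> _]eq_fun do rewrite e2.
under [in X in _ = _ + X -> _]eq_fun do rewrite -lamE.
by [].
Qed.

(** * Convergence *)

(** Heine's theorem on a compact interval with a margin of 1 on each side; for [x] beyond it, both
    points lie where [f] vanishes. *)
Lemma unif_continuous_supp (R : realType) (f : R -> R) :
  continuous f -> zero_outside f ->
  forall e : R, 0 < e -> exists2 d : R, 0 < d & forall x y, `|x - y| < d -> `|f x - f y| <= e.
Proof.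
move=> cf [A fA] e e0.
pose K : set R := `[- (A%:R + 1), A%:R + 1]%classic.
have cK : compact K by exact: segment_compact.
(* Compactness as a covering property along [d] tending to 0 from the right: local radii yield one
   common [d]. *)
have /compact_near_coveringP nK := cK.
pose P (d x : R) := forall y, `|x - y| < d -> `|f x - f y| <= e.
have : \forall d \near (0 : R)^'+, K `<=` P d.
  apply: nK => x Kx.
  have /cvgrPdist_lt /(_ (e / 2)) := cf x; rewrite divr_gt0// => /(_ isT).
  move=> /nbhs_ballP[d /= d0 fd].
  exists (ball x (d / 2), [set r : R | r < d / 2]) => /=.
    split; first by apply: nbhsx_ballx; rewrite divr_gt0.
    by near=> r; near: r; exact: nbhs_right_lt (divr_gt0 d0 _).
  move=> [z r] /= [xz rd] y zy.
  have h1 : `|f x - f z| < e / 2 by apply: fd; apply: le_ball xz; lra.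
  have h2 : `|f x - f y| < e / 2.
    apply: fd; rewrite /ball/= in xz *.
    by rewrite (le_lt_trans (ler_distD z _ _))//; lra.
  by rewrite (le_trans (ler_distD (f x) _ _))// [`|f z - f x|]distrC; lra.
move=> nd.
have nd' : \forall d \near (0 : R)^'+, [/\ K `<=` P d, 0 < d & d < 1].
  near=> d; split; first by near: d.
    by near: d; exact: nbhs_right_gt.
  by near: d; exact: nbhs_right_lt.
have [d [Kd d0 d1]] := @filter_ex _ _ (at_right_proper_filter (0 : R)) _ nd'.
exists d => // x y xy.
have [xK|xK] := boolP (`|x| <= A%:R + 1).
  by apply: Kd => //; rewrite /K /= in_itv /= -ler_norml.
rewrite -ltNge in xK.
have yA : A%:R <= `|y|.
  have := ler_normB x (x - y); rewrite subKr.
  have := ler_distD y x 0; rewrite !subr0; lra.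
by rewrite !fA// ?subrr ?normr0 ?(ltW e0)//; lra.
Unshelve. all: by end_near. Qed.

(** If [|g| <= w + b] everywhere, then [4 |g n| <= 2 w + 2 (w + b)], so the excess [b] is halved.
    Iterating from the bound [B] avoids taking a supremum. *)
Lemma tridiag_le (R : realType) (g : int -> R) (B w : R) :
  (forall n, `|g n| <= B) ->
  (forall n, `|g (n - 1) + 4 * g n + g (n + 1)| <= 2 * w) ->
  forall n, `|g n| <= w.
Proof.
move=> gB gw.
have step (m : nat) n : `|g n| <= w + B / 2 ^+ m.
  elim: m n => [|m IH] n.
    have := gB n; have := le_trans (normr_ge0 _) (gw n).
    by rewrite expr0 divr1; lra.
  have h1 := IH (n - 1); have h2 := IH (n + 1); have h3 := gw n.
  have -> : B / 2 ^+ m.+1 = 2^-1 * (B / 2 ^+ m) by rewrite exprS invfM; ring.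
  move: h1 h2 h3; generalize (B / 2 ^+ m) => b; rewrite !ler_norml.
  by move=> /andP[? ?] /andP[? ?] /andP[? ?]; apply/andP; split; lra.
move=> n; apply/ler_addgt0Pl => e e0; rewrite addrC.
have B0 : 0 <= B := le_trans (normr_ge0 _) (gB n).
apply: le_trans (step (Num.Def.archi_bound (B / e)) n) _.
rewrite lerD2l ler_pdivrMr ?exprn_gt0// -ler_pdivrMl//.
have /ltW := archi_boundP (divr_ge0 B0 (ltW e0)).
rewrite mulrC => /le_trans; apply.
by rewrite -natrX ler_nat ltnW// ltn_expl.
Qed.

(** * B-spline coefficients of the interpolant *)

Lemma normr_rho_le1 (R : realType) : `|rho R| <= 1.
Proof.
have r2 := rho2 R; have : 0 <= rho R + 2 by rewrite -sqrt3E sqrtr_ge0.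
by move=> h; rewrite ler_norml; apply/andP; split; nra.
Qed.

Lemma normr_ccoef_le (R : realType) (n : int) : `|ccoef R n| <= Num.sqrt 3.
Proof.
rewrite /ccoef normrM ger0_norm ?sqrtr_ge0// ler_piMr ?sqrtr_ge0// normrX.
by rewrite exprn_ile1 ?normr_ge0// normr_rho_le1.
Qed.

(* The B-spline coefficients of the cardinal spline interpolating [F] on the integers. *)
Definition bspline_coef (R : realType) (F : int -> R) (n : int) : R :=
  zsum (fun k => F k * ccoef R (n - k)).

(** The a priori bound for [tridiag_le]; its size does not enter the final estimate. *)
Lemma bspline_coef_bounded (R : realType) (F : int -> R) : fin_zsupp F ->
  exists B, forall n, `|bspline_coef F n| <= B.
Proof.
move=> [M F0].
exists (\sum_(i < M + M) `|F (- M%:Z + i%:Z)| * Num.sqrt 3) => n.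
rewrite /bspline_coef (@fin_zsupp_zsum _ _ M (M + M) (- M%:Z)); [|
  by move=> k /F0 ->; rewrite mul0r|lia..].
apply: le_trans (ler_norm_sum _ _ _) _; apply: ler_sum => i _.
by rewrite normrM ler_wpM2l// normr_ccoef_le.
Qed.

(** This is [ccoef_tridiag] convolved with [F]: only the term [k = n] survives. *)
Lemma bspline_coef_tridiag (R : realType) (F : int -> R) (n : int) : fin_zsupp F ->
  bspline_coef F (n - 1) + 4 * bspline_coef F n + bspline_coef F (n + 1) = 6 * F n.
Proof.
move=> finF.
pose u (i : nat) (k : int) : R := F k * ccoef R (n - k + (i%:Z - 1)).
have fu i : fin_zsupp (u i) by exact: fin_zsuppM.
have := zsum_lin 3 (fun i => [:: 1; 4; 1]`_i) fu.
rewrite !big_ord_recr big_ord0 /= add0r !mul1r.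
have e (i : nat) (m : int) : m = n + (i%:Z - 1) -> zsum (u i) = bspline_coef F m.
  by move=> ->; congr zsum; apply: funext => k; congr (_ * ccoef _ _); ring.
rewrite (e 0%N (n - 1))// (e 1%N n); last by ring.
rewrite (e 2%N (n + 1)); last by ring.
move=> <-.
rewrite (@zsum_window _ _ n 1).
  rewrite big_ord1 !big_ord_recr big_ord0 /= add0r !mul1r /u addr0 subrr.
  have := ccoef_tridiag R 0; rewrite eqxx mulr1 => <-.
  by rewrite !add0r (_ : 1%:Z - 1 = 0)//; ring.
move=> k kn; rewrite !big_ord_recr big_ord0 /= add0r !mul1r /u.
have := ccoef_tridiag R (n - k); rewrite (_ : (n - k == 0) = false); last by lia.
rewrite mulr0n mulr0 => h; transitivity (F k * 0); last by rewrite mulr0.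
by rewrite -h !add0r (_ : 1%:Z - 1 = 0)// addr0; ring.
Qed.

(** * Error of the interpolant *)

Lemma SN_interp (R : realType) (f : R -> R) (N : nat) (x : R) :
  zero_outside f -> SN N f x = interp N f x.
Proof.
move=> f_out; elim: N => [|N IH]; last by rewrite interpS// -IH /SN big_ord_recr /= addrA.
rewrite /SN big_ord0 addr0; apply: (congr1 (@zsum R)); apply: funext => k.
by rewrite expr0 divr1 mul1r.
Qed.

(** Exchanging the sum over the samples with the four terms of [L4_local] gives the B-spline
    expansion of the interpolant. *)
Lemma interp_local (R : realType) (f : R -> R) (N : nat) (p : int) (x t : R) :
  zero_outside f -> 0 <= t < 1 -> 2 ^+ N * x = p%:~R + t ->
  let d := bspline_coef (fun k : int => f (k%:~R / 2 ^+ N)) in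
  interp N f x = d (p - 1) * bspline 4 (t + 3) + d p * bspline 4 (t + 2)
    + d (p + 1) * bspline 4 (t + 1) + d (p + 2) * bspline 4 t.
Proof.
move=> f_out t01 xE d; rewrite /interp xE.
pose F (k : int) := f (k%:~R / 2 ^+ N).
pose u (i : nat) (k : int) : R := F k * ccoef R (p + (i%:Z - 1) - k).
have fu i : fin_zsupp (u i) by apply: fin_zsuppM; exact: fin_zsupp_sample.
have L4E k : L4 (p%:~R + t - k%:~R) = ccoef R (p - k - 1) * bspline 4 (t + 3)
    + ccoef R (p - k) * bspline 4 (t + 2)
    + ccoef R (p - k + 1) * bspline 4 (t + 1) + ccoef R (p - k + 2) * bspline 4 t.
  have -> : p%:~R + t - k%:~R = (p - k)%:~R + t :> R by rewrite intrB; ring.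
  exact: L4_local.
move: L4E; generalize (bspline 4 (t + 3)) (bspline 4 (t + 2)).
generalize (bspline 4 (t + 1)) (bspline 4 t).
move=> b1 b0 b3 b2 L4E.
under eq_fun do rewrite L4E.
have := zsum_lin 4 (fun i => [:: b3; b2; b1; b0]`_i) fu.
rewrite !big_ord_recr big_ord0 /= add0r.
have e (i : nat) (m : int) : m = p + (i%:Z - 1) -> zsum (u i) = d m by move=> ->.
rewrite (e 0%N (p - 1))// (e 1%N p); last by ring.
rewrite (e 2%N (p + 1)); last by ring.
rewrite (e 3%N (p + 2)); last by ring.
rewrite ![_ * d _]mulrC => <-.
congr zsum; apply: funext => k; rewrite !big_ord_recr big_ord0 /= add0r /u.
rewrite (_ : p + (0%:Z - 1) - k = p - k - 1); last by ring.
rewrite (_ : p + (1%:Z - 1) - k = p - k); last by ring.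
rewrite (_ : p + (2%:Z - 1) - k = p - k + 1); last by ring.
rewrite (_ : p + (3%:Z - 1) - k = p - k + 2); last by ring.
by rewrite -/(F k); ring.
Qed.

(** One [e] compares coefficients with samples, the other samples with [f x]: the grid points of
    index [p - 1] to [p + 2] lie within two steps of [x]. *)
Lemma interp_error (R : realType) (f : R -> R) (N : nat) (e : R) : zero_outside f ->
  (forall x y, `|x - y| <= 2 / 2 ^+ N -> `|f x - f y| <= e) ->
  forall x, `|f x - interp N f x| <= 2 * e.
Proof.
move=> f_out fe x.
pose F (k : int) := f (k%:~R / 2 ^+ N).
have finF : fin_zsupp F by exact: fin_zsupp_sample.
have N0 : 0 < 2 ^+ N :> R by rewrite exprn_gt0.
pose d := bspline_coef F.
have dF n : `|d n - F n| <= e.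
  have [B dB] := bspline_coef_bounded finF.
  have [M F0] := finF.
  have [C FC] : exists C, forall n, `|F n| <= C.
    exists (\sum_(i < M + M) `|F (- M%:Z + i%:Z)|) => m.
    have [/F0 ->|Mm] := leqP M `|m|; first by rewrite normr0 sumr_ge0.
    have hm : (`|(m + M%:Z)%R| < M + M)%N by lia.
    rewrite (bigD1 (Ordinal hm))//= (_ : - M%:Z + `|(m + M%:Z)%R|%N%:Z = m); last by lia.
    by rewrite lerDl sumr_ge0.
  apply: (@tridiag_le _ (fun n => d n - F n) (B + C)) => m.
    by rewrite (le_trans (ler_normB _ _))// lerD.
  have := bspline_coef_tridiag m finF; rewrite -/d => h.
  (* The tridiagonal equation for [d - F] has two differences of neighbouring samples on the right,
     hence [w = e] in [tridiag_le]. *)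
  have -> : d (m - 1) - F (m - 1) + 4 * (d m - F m) + (d (m + 1) - F (m + 1)) =
    (F m - F (m - 1)) + (F m - F (m + 1)) by lra.
  have hF (s : int) : `|s%:~R : R| <= 2 -> `|F m - F (m + s)| <= e.
    move=> s2; apply: fe; rewrite -mulrBl intrD opprD addrA subrr sub0r mulNr normrN.
    by rewrite normrM normfV (ger0_norm (ltW N0)) ler_pM2r ?invr_gt0.
  have h1 := hF 1; have h2 := hF (-1).
  rewrite (le_trans (ler_normD _ _))// (_ : 2 * e = e + e); last by ring.
  by apply: lerD; [apply: h2; rewrite normrN normr1|apply: h1; rewrite normr1]; lra.
have [p [t t01 xE]] := floor_decomp (2 ^+ N * x).
have near_x (s : int) : `|t - s%:~R| <= 2 -> `|f x - d (p + s)| <= 2 * e.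
  move=> ts.
  have : `|f x - F (p + s)| <= e.
    apply: fe.
    have -> : x - (p + s)%:~R / 2 ^+ N = (t - s%:~R) / 2 ^+ N.
      apply: (mulIf (lt0r_neq0 N0)); rewrite mulrBl !divfK ?lt0r_neq0//.
      by rewrite mulrC xE intrD; ring.
    by rewrite normrM normfV (ger0_norm (ltW N0)) ler_pM2r ?invr_gt0.
  have := dF (p + s); rewrite (distrC (d _)).
  by have := ler_distD (F (p + s)) (f x) (d (p + s)); lra.
rewrite (interp_local f_out t01 xE) -/F -/d.
have tle1 : 0 <= t <= 1 by lra.
have [-> -> -> ->] := bspline4_piece tle1.
have h0 := near_x (-1); have h1 := near_x 0; have h2 := near_x 1; have h3 := near_x 2.
rewrite addr0 in h1.
have {}h0 : `|f x - d (p - 1)| <= 2 * e by apply: h0; rewrite ler_norml; lra.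
have {}h1 : `|f x - d p| <= 2 * e by apply: h1; rewrite ler_norml; lra.
have {}h2 : `|f x - d (p + 1)| <= 2 * e by apply: h2; rewrite ler_norml; lra.
have {}h3 : `|f x - d (p + 2)| <= 2 * e by apply: h3; rewrite ler_norml; lra.
(* These weights are nonnegative with sum 1, so the interpolant is a convex combination of
   coefficients within [2 * e] of [f x]. *)
set w0 := (1 - t) ^+ 3 / 6; set w1 := (4 - 6 * t ^+ 2 + 3 * t ^+ 3) / 6.
set w2 := (1 + 3 * t + 3 * t ^+ 2 - 3 * t ^+ 3) / 6; set w3 := t ^+ 3 / 6.
have ws : w0 + w1 + w2 + w3 = 1 by rewrite /w0 /w1 /w2 /w3; field.
have [t0 t1] := andP tle1.
have w00 : 0 <= w0 by rewrite divr_ge0// exprn_ge0// subr_ge0.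
have w30 : 0 <= w3 by rewrite divr_ge0// exprn_ge0.
have w10 : 0 <= w1.
  rewrite divr_ge0//.
  have -> : 4 - 6 * t ^+ 2 + 3 * t ^+ 3 = (1 - t) * (4 + 4 * t) + t ^+ 2 * (3 * t - 2) by ring.
  nra.
have w20 : 0 <= w2 by rewrite divr_ge0//; nra.
have -> : f x - (d (p - 1) * w0 + d p * w1 + d (p + 1) * w2 + d (p + 2) * w3) =
   w0 * (f x - d (p - 1)) + w1 * (f x - d p) + w2 * (f x - d (p + 1)) + w3 * (f x - d (p + 2)).
  by rewrite -[f x in LHS]mulr1 -ws; ring.
have triangle (a b A B : R) : `|a| <= A -> `|b| <= B -> `|a + b| <= A + B.
  by move=> aA bB; rewrite (le_trans (ler_normD _ _))// lerD.
move: h0 h1 h2 h3; generalize (2 * e) => c h0 h1 h2 h3.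
rewrite -[c]mul1r -ws !mulrDl.
by apply: (triangle _ _ _ _); [apply: (triangle _ _ _ _); [apply: (triangle _ _ _ _)|]|];
  rewrite normrM ger0_norm// ler_wpM2l.
Qed.

Lemma compactly_supported_bounded (R : realType) (f : R -> R) :
  compactly_supported f -> zero_outside f.
Proof.
move=> /compact_bounded[M [_ Mf]].
(* As [|M| + 1] exceeds [M], it bounds the support, and the Archimedean bound lies strictly above
   it. *)
exists (Num.Def.archi_bound (`|M| + 1)) => x Ax; apply/eqP/negPn/negP => fx0.
have M1 : M < `|M| + 1 by rewrite (le_lt_trans (ler_norm _))// ltrDl.
have /= := Mf _ M1 x (@subset_closure _ [set x | f x != 0] x fx0).
have := archi_boundP (addr_ge0 (normr_ge0 M) ler01).
by lra.
Qed.

Theorem theorem3p5 (R : realType) (f : R -> R)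
    (f_cont : continuous f) (f_supp : compactly_supported f) :
  (fun N : nat => supnorm (fun x : R => f x - SN N f x)) @ \oo --> 0%E.
Proof.
have f_out := compactly_supported_bounded f_supp.
pose E (N : nat) := supnorm (fun x : R => f x - SN N f x).
have norm_ge0 (N : nat) : (0 <= E N)%E.
  apply: le_trans (ereal_sup_ubound _); last by exists (0 : R).
  by rewrite lee_fin.
have small (e : R) : 0 < e -> \forall N \near \oo, (E N <= e%:E)%E.
  move=> e0.
  have e20 : 0 < e / 2 by rewrite divr_gt0.
  have [d d0 fd] := unif_continuous_supp f_cont f_out e20.
  (* For these [N], [2 ^ N > N > 2 / d], so two grid steps are shorter than [d]. *)
  exists (Num.Def.archi_bound (2 / d)) => // N /= dN.
  apply: ge_ereal_sup => _ [x _ <-]; rewrite lee_fin SN_interp//.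
  rewrite (_ : e = 2 * (e / 2)); last by field.
  apply: interp_error => // a b ab; apply: fd; apply: le_lt_trans ab _.
  rewrite ltr_pdivrMr ?exprn_gt0// -ltr_pdivrMl//.
  rewrite mulrC (lt_le_trans (archi_boundP _))//; first by rewrite divr_ge0// ltW.
  by rewrite -natrX ler_nat (leq_trans dN)// ltnW// ltn_expl.
(* Convergence to a finite limit in the extended reals: eventual finiteness, here from the bound 1,
   and convergence of the real parts. *)
rewrite -/E; apply/fine_cvgP; split.
  near=> N; rewrite ge0_fin_numE; last exact: norm_ge0.
  apply: (@le_lt_trans _ _ 1%:E); last by rewrite ltry.
  by near: N; exact: small.
apply/cvgrPdist_le => e e0; near=> N.
have EN : (E N <= e%:E)%E by near: N; exact: small.
rewrite sub0r normrN /= ger0_norm; last exact: (fine_ge0 (norm_ge0 N)).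
rewrite -lee_fin fineK// ge0_fin_numE; last exact: norm_ge0.
by apply: le_lt_trans EN _; rewrite ltry.
Unshelve. all: by end_near. Qed.
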